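(* Let $0<\alpha<1$ and let $\mu$ be the measure on $\Omega\times\mathbb{N}$ given by $d\mu=\mu_k\,dP\otimes dm$, where the $\mu_k$ ($k\in\mathbb{N}$) are nonnegative random variables. (1) If $\mu$ is a bounded $\alpha$-Carleson measure and $1<p<\infty$, then for all adapted processes $f=(f_n)_{n\ge0}$, $$\int_{\Omega\times\mathbb{N}}|f_k|^p\mu_k\,dP\otimes dm\le\frac{p}{p-1}\,|||\mu|||_\alpha\,\|Mf\|_{L^{\frac{1}{2\alpha}}}\,\|Mf\|_{L^{p-1}}^{p-1},$$ where $Mf$ is the maximal function of $f=(f_n)_{n\ge0}$. (2) Conversely, if for some $1<p<\infty$ there is a constant $C_p$ such that $$\int_{\Omega\times\mathbb{N}}|f_k|^p\mu_k\,dP\otimes dm\le C_p\,\|Mf\|_{L^{\frac{1}{2\alpha}}}\,\|Mf\|_{L^{p-1}}^{p-1}$$ for all adapted processes $f=(f_n)_{n\ge0}$, then $\mu$ is a bounded $\alpha$-Carleson measure and $|||\mu|||_\alpha\le C_p$.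
   Context: $(\Omega,\mathcal{F},P)$ is a complete probability space and $(\mathcal{F}_n)_{n\ge 0}$ is an increasing sequence of sub-$\sigma$-fields of $\mathcal{F}$ with $\mathcal{F}=\bigvee_n\mathcal{F}_n$. Adapted processes $f=(f_n)_{n\ge0}$ are scalar-valued and adapted to $(\mathcal{F}_n)$, and $Mf=\sup_{n\ge0}|f_n|$. For $0<q<\infty$, $\|g\|_{L^q}=\big(\int_\Omega|g|^q\,dP\big)^{1/q}$ (only a quasi-norm when $q<1$). $\mathbb{N}=\{0,1,2,\dots\}$ and $dm$ is the counting measure on $\mathbb{N}$. Stopping times are relative to $(\mathcal{F}_n)$ and take values in $\{0,1,2,\dots\}\cup\{\infty\}$. The tent over a stopping time $\tau$ is $\widehat{\tau}=\{(\omega,k)\in\Omega\times\mathbb{N}: k\ge\tau(\omega),\ \tau(\omega)<\infty\}$. A nonnegative measure $\mu$ on $\Omega\times\mathbb{N}$ is a bounded $\alpha$-Carleson measure if $$|||\mu|||_\alpha:=\sup_\tau\frac{\mu(\widehat{\tau})}{P(\tau<\infty)^{1+2\alpha}}<\infty,$$ the supremum being over all stopping times $\tau$ (with $P(\tau<\infty)>0$). *)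

(* Defs.v *)
From HB Require Import structures.
From mathcomp Require Import all_boot all_order all_algebra.
From mathcomp Require Import complex.
From mathcomp Require Import all_classical all_reals all_analysis.
From mathcomp Require Import measurable_realfun.

Set Implicit Arguments.
Unset Strict Implicit.
Unset Printing Implicit Defensive.

Import Order.TTheory GRing.Theory Num.Theory.
Import numFieldNormedType.Exports.

Local Open Scope classical_set_scope.
Local Open Scope ring_scope.

(* The library declares [counting] on nat sigma-finite but not s-finite, so that
   it is not yet a [{sigma_finite_measure set nat -> \bar R}]. *)
HB.instance Definition _ (R : realType) :=
  @isSFinite.Build _ nat R (@counting nat R)
    (sfinite_measure_sigma_finite (sigma_finite_counting R)).

(* A filtration by sub-sigma-fields which generates the ambient sigma-field;
   each sub-sigma-field is given as the set of its events. *)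
Record filtration d (T : measurableType d) (F : nat -> set (set T)) : Prop := {
  filtration_sigma : forall n, sigma_algebra setT (F n) ;
  filtration_sub : forall n, F n `<=` measurable ;
  filtration_incr : forall n, F n `<=` F n.+1 ;
  filtration_gen : <<s \bigcup_n F n >> = measurable }.

Variant scalar_field := RealScalars | ComplexScalars.

(* Scalars are elements of R[i]; real scalars have zero imaginary part. *)
Definition is_scalar (R : realType) (K : scalar_field) (z : R[i]) : Prop :=
  match K with RealScalars => complex.Im z = 0 | ComplexScalars => True end.

(* R[i] carries no sigma-field in the library: a scalar function is measurable
   when its real and imaginary parts are. *)
Record adapted (R : realType) (K : scalar_field) d (T : measurableType d)
    (F : nat -> set (set T)) (f : nat -> T -> R[i]) : Prop := {
  adapted_scalar : forall n t, is_scalar K (f n t) ;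
  adapted_Re : forall n (B : set R), measurable B ->
    F n ((fun t => complex.Re (f n t)) @^-1` B) ;
  adapted_Im : forall n (B : set R), measurable B ->
    F n ((fun t => complex.Im (f n t)) @^-1` B) }.

Definition maximal_function (R : realType) (T : Type) (f : nat -> T -> R[i]) (t : T)
  : \bar R := ereal_sup (range (fun n => (Normc.normc (f n t))%:E)).

(* Random times are [option nat]-valued, [None] standing for infinity. *)
Definition stopping_time d (T : measurableType d) (F : nat -> set (set T))
    (tau : T -> option nat) : Prop :=
  forall n, F n [set t | exists2 k, tau t = Some k & (k <= n)%N].

Definition finite_event (T : Type) (tau : T -> option nat) : set T :=
  [set t | exists k, tau t = Some k].

Definition tent (T : Type) (tau : T -> option nat) : set (T * nat) :=
  [set x | exists2 k, tau x.1 = Some k & (k <= x.2)%N].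

Section carleson.
Context d (T : measurableType d) (R : realType) (P : probability T R).
Local Open Scope ereal_scope.

Definition carleson_norm (F : nat -> set (set T)) (alpha : R)
    (mu : {measure set (T * nat) -> \bar R}) : \bar R :=
  ereal_sup [set mu (tent tau) / P (finite_event tau) `^ (1 + 2 * alpha)%R
            | tau in [set tau | stopping_time F tau /\
                                0 < P (finite_event tau)]].

Definition bounded_carleson (F : nat -> set (set T)) (alpha : R)
    (mu : {measure set (T * nat) -> \bar R}) : Prop :=
  carleson_norm F alpha mu < +oo.

End carleson.

Section weighted_measure.
Context d (T : measurableType d) (R : realType) (P : probability T R).
Variable w : nat -> {RV P >-> R}.
Hypothesis w0 : forall k t, 0 <= w k t.
Local Open Scope ereal_scope.

Definition weighted_measure of (forall k t, (0 <= w k t)%R) :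
    set (T * nat) -> \bar R :=
  fun A => \int[P \x counting]_(x in A) (w x.2 x.1)%:E.

Let measurable_weight :
  measurable_fun setT ((fun x => (w x.2 x.1)%:E) : T * nat -> \bar R).
Proof.
apply/measurable_EFinP => _ B mB; rewrite setTI.
rewrite (_ : _ @^-1` B = \bigcup_k ((w k @^-1` B) `*` [set k])).
  apply: bigcup_measurable => k _; apply: measurableX => //.
  by rewrite -[X in measurable X]setTI; exact: measurable_funP.
apply/seteqP; split=> [[t k] /= Bt|[t k] /= [j _ [/= Bt ->]]//].
by exists k.
Qed.

Let weighted_measure0 : weighted_measure w0 set0 = 0.
Proof. by rewrite /weighted_measure integral_set0. Qed.

Let weighted_measure_ge0 A : 0 <= weighted_measure w0 A.
Proof. by apply: integral_ge0 => x _; rewrite lee_fin. Qed.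

Let weighted_measure_sigma_additive : semi_sigma_additive (weighted_measure w0).
Proof.
by apply: semi_sigma_additive_nng_induced => // x; rewrite lee_fin.
Qed.

HB.instance Definition _ := isMeasure.Build _ _ _ (weighted_measure w0)
  weighted_measure0 weighted_measure_ge0 weighted_measure_sigma_additive.

End weighted_measure.
Arguments weighted_measure {d T R} P {w} _ _.

(* Main.v *)
(** For [s > 0] let [tau] be the first time at which [|f_n|^(p-1) > s].  The level
    set [{|f_k|^(p-1) > s}] lies in the tent over [tau], and [tau] is finite only
    where [(Mf)^(p-1) > s], so its [mu]-measure is at most
    [|||mu||| P((Mf)^(p-1) > s)^(1+2alpha)].  Chebyshev's inequality bounds
    [s^(1/(p-1)) P((Mf)^(p-1) > s)^(2alpha)] by the norm of [Mf] in
    [L^(1/(2alpha))], and integrating the remaining factor over [s] gives the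
    integral of [(Mf)^(p-1)].  The factor [p/(p-1)] comes from
    [u^(b+1) = (b+1) int_0^u s^b ds] with [b = 1/(p-1)] and [u = |f_k|^(p-1)].
    Conversely, the process [f_k = 1_(tau <= k)] has [|f_k|^p] equal to the
    indicator of the tent over [tau] and [Mf = 1_(tau < oo)]. *)

Require Import Defs.
From HB Require Import structures.
From mathcomp Require Import all_boot all_order all_algebra.
From mathcomp Require Import complex.
From mathcomp Require Import all_classical all_reals all_analysis.
From mathcomp Require Import measurable_realfun.

Set Implicit Arguments.
Unset Strict Implicit.
Unset Printing Implicit Defensive.

Import Order.TTheory GRing.Theory Num.Theory.
Import numFieldNormedType.Exports.

Local Open Scope classical_set_scope.
Local Open Scope ring_scope.
Local Open Scope ereal_scope.

(** * Integrals of real powers over bounded intervals *)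

Section powR_integral.
Context {R : realType}.
Local Notation mu := (@lebesgue_measure R).
Implicit Types (b h : R).

Lemma powR_cvg0_at_right b : (0 <= b)%R -> ((s `^ b) @[s --> 0^'+] --> (0 `^ b : R))%R.
Proof.
rewrite le_eqVlt => /predU1P[<-|b0].
  by under eq_fun do rewrite powRr0; rewrite powRr0; exact: cvg_cst.
by rewrite powR0 ?gt_eqF//; exact: powR_cvg0.
Qed.

Lemma continuous_powR b (x : R) : (0 < x)%R ->
  {for x, continuous (fun s : R => s `^ b)}%R.
Proof.
move=> x0; apply/differentiable_continuous/derivable1_diffP.
by apply: derivable_powR; rewrite in_itv/= x0.
Qed.

Lemma within_continuous_powR b h : (0 <= b)%R -> (0 < h)%R ->
  {within `[0%R, h], continuous (fun s : R => s `^ b)%R}.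
Proof.
move=> b0 h0; apply/(continuous_within_itvP _ h0); split.
- by move=> x; rewrite in_itv/= => /andP[x0 _]; exact: continuous_powR.
- exact: powR_cvg0_at_right.
- exact/cvg_at_left_filter/continuous_powR.
Qed.

Lemma integral_powR b h : (0 <= b)%R -> (0 <= h)%R ->
  \int[mu]_(s in `[0%R, h]) (s `^ b)%:E = (h `^ (b + 1) / (b + 1))%:E.
Proof.
move=> b0; have b1 : (0 < b + 1)%R by rewrite ltr_wpDl.
rewrite le_eqVlt => /predU1P[<-|h0].
  by rewrite set_itv1 integral_set1 powR0 ?gt_eqF// mul0r.
have [_ F0 Fh] := (continuous_within_itvP _ h0).1
  (within_continuous_powR (ltW b1) h0).
(* The antiderivative has to be derivable only in the open interval and to have one-sided limits at
   the ends, so the behaviour of powers at 0 does no harm. *)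
rewrite (@continuous_FTC2 _ _ (fun s => (b + 1)^-1 * s `^ (b + 1))%R _ _ h0).
- by rewrite powR0 ?gt_eqF// mulr0 sube0 mulrC.
- exact: within_continuous_powR.
- split.
  + move=> x; rewrite in_itv/= => /andP[x0 _].
    by apply: derivableM => //; apply: derivable_powR; rewrite in_itv/= x0.
  + exact: cvgMl_tmp.
  + exact: cvgMl_tmp.
- move=> x; rewrite in_itv/= => /andP[x0 _].
  rewrite derive1E deriveM//; last by apply: derivable_powR; rewrite in_itv/= x0.
  have [_ ->] := is_derive1_powR (b + 1) x0.
  by rewrite derive_cst scaler0 addr0 addrK scalerA mulVf ?gt_eqF// scale1r.
Qed.

End powR_integral.

(** Superlevel sets [[set s | s%:E < r]] are unbounded below; extending the power by zero cuts them
    down to positive [s]. With [b = 0] this is the indicator of the positive half-line. *)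
Definition pos_powR (R : realType) (b : R) : R -> \bar R :=
  (fun s => (s `^ b)%:E) \_ `]0%R, +oo[.

(** * Layer-cake formulas from Tonelli's theorem *)

Section layer_cake.
Context {R : realType} d (X : measurableType d).
Variable m : {sigma_finite_measure set X -> \bar R}.
Local Notation mu := (@lebesgue_measure R).

Lemma measurable_superlevel (h : X -> \bar R) (s : R) : measurable_fun setT h ->
  measurable [set x | s%:E < h x].
Proof.
by move=> mh; rewrite -[X in measurable X]setTI; exact: emeasurable_fun_o_infty.
Qed.

Lemma measurable_superlevel_prod (h : X -> \bar R) : measurable_fun setT h ->
  measurable [set z : X * measurableTypeR R | z.2%:E < h z.1].
Proof.
move=> mh; rewrite -[X in measurable X]setTI; apply: measurable_lte => //.
  by apply/measurable_EFinP; exact: measurable_snd.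
exact: measurableT_comp.
Qed.

(** This is a partial integral of [g] restricted to the region below the graph of [h], which is
    measurable in the product, so Tonelli's theorem supplies measurability in [s]. *)
Lemma measurable_integral_superlevel (g h : X -> \bar R) :
  measurable_fun setT g -> measurable_fun setT h -> (forall x, 0 <= g x) ->
  measurable_fun setT (fun s : R => \int[m]_(x in [set x | s%:E < h x]) g x).
Proof.
move=> mg mh g0; pose A := [set z : X * measurableTypeR R | z.2%:E < h z.1].
pose G := (fun z : X * measurableTypeR R => g z.1) \_ A.
have mG : measurable_fun setT G.
  apply/(measurable_restrictT _ (measurable_superlevel_prod mh)).
  by apply: measurable_funTS; exact: measurableT_comp.
have G0 z : 0 <= G z by apply: erestrict_ge0 => y _; exact: g0.
have := @measurable_fun_fubini_tonelli_G _ _ _ _ _ m _ mG G0.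
congr measurable_fun; apply/funext => s; rewrite /fubini_G [RHS]integral_mkcond.
apply: eq_integral => x _.
by rewrite /G !patchE /A /=; congr (if _ then _ else _).
Qed.

(** Both sides are iterated integrals of [g x * phi s] over the region [s < h x], taken in the two
    orders. *)
Lemma tonelli_superlevel (phi : R -> \bar R) (g h : X -> \bar R) :
  measurable_fun setT phi -> measurable_fun setT g -> measurable_fun setT h ->
  (forall s, 0 <= phi s) -> (forall x, 0 <= g x) ->
  \int[m]_x (g x * \int[mu]_(s in [set s | s%:E < h x]) phi s)
  = \int[mu]_s (phi s * \int[m]_(x in [set x | s%:E < h x]) g x).
Proof.
move=> mphi mg mh phi0 g0.
pose A := [set z : X * measurableTypeR R | z.2%:E < h z.1].
pose G (z : X * measurableTypeR R) := g z.1 * phi z.2.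
have mA : measurable A := measurable_superlevel_prod mh.
have mG : measurable_fun setT G.
  by apply: emeasurable_funM; [exact: measurableT_comp|exact: measurableT_comp].
have mGA : measurable_fun setT (G \_ A).
  by apply/(measurable_restrictT _ mA); exact: measurable_funTS.
have GA0 z : 0 <= (G \_ A) z.
  by apply: erestrict_ge0 => // y _; rewrite mule_ge0.
have mphix x : measurable [set s : R | s%:E < h x].
  by rewrite -[X in measurable X]setTI; apply: measurable_lte => //;
    exact/measurable_EFinP.
transitivity (\int[m]_x \int[mu]_s (G \_ A) (x, s)).
  apply: eq_integral => x _.
  rewrite -ge0_integralZl//; [|exact: mphix|exact: measurable_funTS].
  rewrite integral_mkcond; apply: eq_integral => s _.
  by rewrite !patchE /G /A /=; congr (if _ then _ else _).
transitivity (\int[mu]_s \int[m]_x (G \_ A) (x, s)).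
  exact: (@fubini_tonelli _ _ _ _ _ m mu _ mGA GA0).
apply: eq_integral => s _.
rewrite /= -ge0_integralZl//; [|exact: measurable_superlevel|exact: measurable_funTS].
rewrite [RHS]integral_mkcond; apply: eq_integral => x _.
by rewrite !patchE /G /A /= muleC; congr (if _ then _ else _).
Qed.

Lemma integral_powR_superlevel b r : (0 <= b)%R -> (0 <= r)%R ->
  \int[mu]_(s in [set s | s%:E < r%:E]) pos_powR b s = (r `^ (b + 1) / (b + 1))%:E.
Proof.
move=> b0 r0; rewrite -integral_powR// /pos_powR -integral_mkcondr.
(* The closed interval is opened at both ends, which are Lebesgue null. *)
rewrite -integral_itv_obnd_cbnd; last first.
  by apply/measurable_EFinP/measurable_funTS; exact: measurable_powR.
rewrite -integral_itv_bndo_bndc; last first.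
  by apply/measurable_EFinP/measurable_funTS; exact: measurable_powR.
congr integral; apply/seteqP; split=> s /=; rewrite !in_itv/= andbT lte_fin.
  by case=> -> ->.
by move=> /andP[-> ->].
Qed.

(** The value [+oo] has to be covered, since a maximal function may be infinite; there the integral
    is the length of the half-line. *)
Lemma integral_cst1_superlevel (r : \bar R) : 0 <= r ->
  \int[mu]_(s in [set s | s%:E < r]) pos_powR 0 s = r.
Proof.
case: r => [r r0| _|//].
  by rewrite integral_powR_superlevel// add0r divr1 powRr1.
rewrite /pos_powR -integral_mkcondr (_ : [set s | s%:E < +oo] = setT); last first.
  by apply/seteqP; split=> s //= _; rewrite ltry.
rewrite setTI; under eq_integral do rewrite powRr0.
by rewrite integral_cst//= mul1e lebesgue_measure_itv/= ltry addye.
Qed.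

Lemma measurable_pos_powR (b : R) : measurable_fun setT (pos_powR b).
Proof.
apply/(measurable_restrictT _ (measurable_itv _)).
by apply/measurable_EFinP/measurable_funTS; exact: measurable_powR.
Qed.

Lemma pos_powR_ge0 (b s : R) : 0 <= pos_powR b s.
Proof. by apply: erestrict_ge0 => // t _; rewrite lee_fin powR_ge0. Qed.

Lemma layer_cake b (g : X -> \bar R) (h : X -> R) : (0 <= b)%R ->
  measurable_fun setT g -> measurable_fun setT h ->
  (forall x, 0 <= g x) -> (forall x, (0 <= h x)%R) ->
  \int[m]_x (g x * (h x `^ (b + 1) / (b + 1))%:E) =
  \int[mu]_s (pos_powR b s * \int[m]_(x in [set x | (s < h x)%R]) g x).
Proof.
move=> b0 mg mh g0 h0.
rewrite -(@tonelli_superlevel _ _ (EFin \o h))//.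
- by apply: eq_integral => x _; rewrite integral_powR_superlevel.
- exact: measurable_pos_powR.
- exact/measurable_EFinP.
- exact: pos_powR_ge0.
Qed.

Lemma integral_superlevel (h : X -> \bar R) :
  measurable_fun setT h -> (forall x, 0 <= h x) ->
  \int[mu]_s (pos_powR 0 s * m [set x | s%:E < h x]) = \int[m]_x h x.
Proof.
move=> mh h0; under eq_integral => s _.
  rewrite -[m _]mul1e -integral_cst; last exact: measurable_superlevel.
  over.
rewrite -(@tonelli_superlevel _ (cst 1))//; [|exact: measurable_pos_powR|exact: pos_powR_ge0].
by apply: eq_integral => x _; rewrite mul1e integral_cst1_superlevel.
Qed.

End layer_cake.

(** * Adapted processes, stopping times and tents *)

Section adapted_processes.
Context {R : realType} d (T : measurableType d).
Implicit Types (F : nat -> set (set T)) (f : nat -> T -> R[i]).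

(** Turns membership of preimages in a sub-sigma-field into measurability on a type carrying that
    field, so that closure properties of measurable functions apply to each [F n]. *)
Lemma sigma_algebra_preimage (G : set (set T)) (g : T -> R) :
  sigma_algebra setT G ->
  measurable_fun setT (g : g_sigma_algebraType G -> R) <->
  forall B, measurable B -> G (g @^-1` B).
Proof.
move=> sG; split => [mg B mB|mg _ B mB].
  by have := mg measurableT B mB; rewrite setTI /measurable/= sigma_algebra_id.
by rewrite setTI /measurable/= sigma_algebra_id//; exact: mg.
Qed.

Lemma normcE (z : R[i]) :
  Normc.normc z = Num.sqrt (complex.Re z ^+ 2 + complex.Im z ^+ 2)%R.
Proof. by case: z. Qed.

Lemma normc_ge0 (z : R[i]) : (0 <= Normc.normc z)%R.
Proof. by rewrite normcE sqrtr_ge0. Qed.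

Lemma adapted_normc K F f n (B : set R) : filtration F -> adapted K F f ->
  measurable B -> F n ((fun t => Normc.normc (f n t)) @^-1` B).
Proof.
move=> hF hf mB; have sF := filtration_sigma hF n.
move: B mB; apply/(sigma_algebra_preimage _ sF).
under eq_fun do rewrite normcE.
apply: (@measurableT_comp _ _ _ _ _ _ (@Num.sqrt R)).
  by apply: continuous_measurable_fun; exact: sqrt_continuous.
apply: measurable_funD; apply: measurable_funX.
  by apply/(sigma_algebra_preimage _ sF) => B mB; exact: adapted_Re hf _ _ mB.
by apply/(sigma_algebra_preimage _ sF) => B mB; exact: adapted_Im hf _ _ mB.
Qed.

Lemma measurable_normc_adapted K F f n : filtration F -> adapted K F f ->
  measurable_fun setT (fun t => Normc.normc (f n t)).
Proof.
move=> hF hf _ B mB; rewrite setTI.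
by apply: (filtration_sub hF); exact: adapted_normc hF hf mB.
Qed.

Lemma measurable_maximal_function K F f : filtration F -> adapted K F f ->
  measurable_fun setT (maximal_function f).
Proof.
move=> hF hf.
rewrite (_ : maximal_function f =
  (fun t => esups (fun n => (Normc.normc (f n t))%:E) 0%N)); last first.
  apply/funext => t; congr ereal_sup; apply/seteqP; split => [_ [n _ <-]|_ [n _ <-]].
    by exists n.
  by exists n.
by apply: measurable_fun_esups => n; apply/measurable_EFinP;
  exact: measurable_normc_adapted hF hf.
Qed.

Lemma filtration_le F m n : filtration F -> (m <= n)%N -> F m `<=` F n.
Proof.
move=> hF; elim: n => [|n IH]; first by rewrite leqn0 => /eqP ->.
rewrite leq_eqVlt ltnS => /predU1P[->//|/IH mn A /mn].
exact: filtration_incr.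
Qed.

Lemma sigma_algebra_bigcup_le F n (A : nat -> set T) : filtration F ->
  (forall k, F k (A k)) -> F n [set t | exists2 k, A k t & (k <= n)%N].
Proof.
move=> hF FA; have [F0 _ FU] := filtration_sigma hF n.
(* The finite union is padded with empty sets, since sigma-algebras are closed under countable
   unions. *)
rewrite (_ : [set t | _] = \bigcup_k (if (k <= n)%N then A k else set0)).
  by apply: FU => k; case: ifPn => // kn; exact: (filtration_le hF kn).
apply/seteqP; split => [t [k Akt kn]|t [k _]]; first by exists k; rewrite // kn.
by case: ifPn => // kn Akt; exists k.
Qed.

Lemma measurable_finite_event F tau : filtration F -> stopping_time F tau ->
  measurable (finite_event tau).
Proof.
move=> hF htau.
rewrite (_ : finite_event tau =
    \bigcup_n [set t | exists2 k, tau t = Some k & (k <= n)%N]).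
  by apply: bigcupT_measurable => n; exact/(filtration_sub hF)/htau.
by apply/seteqP; split => [t [k tk]|t [n _ [k tk _]]]; [exists k => //; exists k|exists k].
Qed.

Lemma measurable_nat_prod d' (Y : measurableType d') (g : nat -> T -> Y) :
  (forall k, measurable_fun setT (g k)) ->
  measurable_fun setT (fun x : T * nat => g x.2 x.1).
Proof.
move=> mg _ B mB; rewrite setTI.
rewrite (_ : _ @^-1` B = \bigcup_k ((g k @^-1` B) `*` [set k])).
  apply: bigcupT_measurable => k; apply: measurableX => //.
  by rewrite -[X in measurable X]setTI; exact: mg.
apply/seteqP; split=> [[t k] /= Bt|[t k] /= [j _ [/= Bt ->]]//].
by exists k.
Qed.

Lemma measurable_tent F tau : filtration F -> stopping_time F tau ->
  measurable (tent tau).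
Proof.
move=> hF htau.
rewrite (_ : tent tau = \bigcup_n ([set t | exists2 k, tau t = Some k & (k <= n)%N] `*`
    [set n])).
  apply: bigcupT_measurable => n; apply: measurableX => //.
  exact/(filtration_sub hF)/htau.
apply/seteqP; split => [[t n] [k tk kn]|[t n] [m _ [[k /= tk kn] /= ->]]]; last by exists k.
by exists n => //; split => //; exists k.
Qed.

(** Take for [tau] the first [n] at which the point lies in [A n]. If [t] is in [A n], then [tau t]
    is at most [n], which puts [(t, n)] in the tent. *)
Lemma hitting_time F (A : nat -> set T) : filtration F -> (forall n, F n (A n)) ->
  exists tau, [/\ stopping_time F tau, finite_event tau `<=` \bigcup_n A n &
    [set x : T * nat | A x.2 x.1] `<=` tent tau].
Proof.
move=> hF FA.
pose tau t := if pselect (exists n, `[< A n t >]) is left ex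
  then Some (ex_minn ex) else None.
have tauP t k : tau t = Some k -> A k t.
  by rewrite /tau; case: pselect => // ex [<-]; case: ex_minnP => m /asboolP.
have taule t n : A n t -> exists2 k, tau t = Some k & (k <= n)%N.
  move=> Ant; rewrite /tau; case: pselect => [ex|/= nex]; last first.
    by exfalso; apply: nex; exists n; exact/asboolP.
  by exists (ex_minn ex) => //; case: ex_minnP => m _; apply; exact/asboolP.
exists tau; split => [n|t [k /tauP]|[t n] /taule//]; last by exists k.
(* Stopping no later than [n] means having visited some [A k] with [k <= n], an event of [F n]. *)
rewrite (_ : [set t | _] = [set t | exists2 k, A k t & (k <= n)%N]).
  exact: sigma_algebra_bigcup_le.
apply/seteqP; split => t [k]; first by move=> /tauP; exists k.
by move=> /taule[j ? jk] kn; exists j => //; exact: leq_trans kn.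
Qed.

End adapted_processes.

Lemma lee_pdiv_fin (R : realType) (x y z : \bar R) : 0 < z -> z \is a fin_num ->
  (x / z <= y) = (x <= y * z).
Proof.
by case: z => // r; rewrite lte_fin => r0 _; rewrite inver gt_eqF// lee_pdivrMr.
Qed.

Lemma chebyshev_Lnorm (R : realType) d (T : measurableType d)
    (m : {measure set T -> \bar R}) (M : T -> \bar R) (q s : R) :
  measurable_fun setT M -> (0 < q)%R -> (0 < s)%R ->
  s%:E * m [set t | s%:E < M t] `^ q^-1 <= 'N[m]_q%:E[M].
Proof.
move=> mM q0 s0; rewrite unlock.
have qy (x : \bar R) : 0 <= x -> x \in `[0%E, +oo%E]%R by move=> x0; rewrite in_itv/= x0 leey.
(* Writing [s] as a [q]-th root makes the whole left side a single root, so that the bases can be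
   compared. *)
have sE : s%:E = (s%:E `^ q) `^ q^-1.
  by rewrite -poweRrM divff ?gt_eqF// poweRe1// lee_fin ltW.
rewrite [X in X * _]sE.
rewrite -poweRM ?poweR_ge0//; apply: gt0_ler_poweR; rewrite ?invr_ge0 ?(ltW q0)//.
- by rewrite qy// mule_ge0 ?poweR_ge0.
- by rewrite qy// integral_ge0// => t _; rewrite poweR_ge0.
have mS := measurable_superlevel s mM.
have : (s%:E `^ q) * m (setT `&` [set t | s%:E <= `|M t|]) <= \int[m]_t (`|M t| `^ q).
  apply: (@le_integral_comp_abse _ _ _ m _ measurableT M s (fun x => x `^ q)) => //.
  - exact: measurable_poweR.
  - by move=> r _; exact: poweR_ge0.
  - move=> x y; rewrite !inE/= !in_itv/= !andbT => x0 y0 xy.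
    by apply: gt0_ler_poweR => //; [exact: ltW|exact: qy|exact: qy].
move=> lechv; apply: le_trans lechv; rewrite setTI lee_wpmul2l ?poweR_ge0// le_measure ?inE//.
  rewrite -[X in measurable X]setTI; apply: emeasurable_fun_c_infty => //.
  exact: measurableT_comp.
by move=> t /= /ltW st; exact: le_trans st (lee_abs _).
Qed.

(** * Tent estimates from the Carleson norm *)

Section carleson.
Context {R : realType} d (T : measurableType d) (P : probability T R).
Variables (F : nat -> set (set T)) (alpha : R) (w : nat -> {RV P >-> R}).
Hypotheses (hF : filtration F) (w0 : forall k t, (0 <= w k t)%R).
Hypothesis alpha0 : (0 < alpha)%R.
Local Notation nu := (weighted_measure P w0).
Local Notation c := (carleson_norm P F alpha nu).

Let alpha1 : (0 < 1 + 2 * alpha)%R.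
Proof. by rewrite addr_gt0// mulr_gt0. Qed.

Lemma measurable_weight :
  measurable_fun setT (fun x : T * nat => (w x.2 x.1)%:E).
Proof. by apply/measurable_EFinP; apply: (measurable_nat_prod (g := fun k => w k)) => k. Qed.

(** Absolute continuity with respect to the product measure handles stopping times that are almost
    surely infinite, which the supremum in [carleson_norm] leaves out. *)
Lemma weighted_measure_null (A : set T) (B : set (T * nat)) : measurable A ->
  measurable B -> B `<=` A `*` setT -> P A = 0 -> nu B = 0.
Proof.
move=> mA mB BA PA; apply: null_set_integral => //.
- by apply: measurable_funTS; exact: measurable_weight.
- apply: (@subset_measure0 _ _ _ (P \x counting) _ (A `*` setT)) => //; first exact: measurableX.
  transitivity (P A * counting [set: nat]); last by rewrite PA mul0e.
  exact: (product_measure1E P counting mA (measurableT : measurable [set: nat])).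
Qed.

Lemma le_carleson_norm tau : stopping_time F tau ->
  nu (tent tau) <= c * P (finite_event tau) `^ (1 + 2 * alpha).
Proof.
move=> htau; have mtau := measurable_finite_event hF htau.
have : 0 <= P (finite_event tau) by [].
rewrite le_eqVlt => /predU1P[P0|P0].
  rewrite -P0 poweR0r ?gt_eqF// mule0.
  rewrite (weighted_measure_null mtau (measurable_tent hF htau))//.
  by move=> [t n] [k tk _]; split => //; exists k.
rewrite -lee_pdiv_fin ?poweR_gt0 ?fin_num_poweR ?fin_num_measure//.
by apply: ereal_sup_ubound; exists tau.
Qed.

(** A supremum over an empty set would be [-oo]; the stopping time constantly 0 shows that some
    nonnegative quotient occurs. *)
Lemma carleson_norm_ge0 : 0 <= c.
Proof.
pose tau := fun _ : T => Some 0%N.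
have tauT : finite_event tau = setT by apply/seteqP; split => t // _; exists 0%N.
apply: (@le_trans _ _ (nu (tent tau) / P (finite_event tau) `^ (1 + 2 * alpha))).
  by rewrite mule_ge0// inve_ge0 poweR_ge0.
apply: ereal_sup_ubound; exists tau => //=; split; last by rewrite tauT probability_setT.
move=> n; rewrite (_ : [set t | _] = setT); last first.
  by apply/seteqP; split => t // _; exists 0%N.
by have [F0 FC _] := filtration_sigma hF n; rewrite -(setD0 setT); exact: FC.
Qed.

End carleson.

(** * Sigma-finiteness of the product with counting measure, as Tonelli's theorem requires *)

Section product_counting.
Context {R : realType} d (T : measurableType d) (P : probability T R).
Lemma sigma_finite_product_counting : sigma_finite setT (P \x @counting nat R).
Proof.
have [G TG Gfin] := sigma_finite_counting R.
exists (fun n => setT `*` G n).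
  apply/seteqP; split=> [[t k] _|//].
  have [n _ Gk] : (\bigcup_n G n) k by rewrite -TG.
  by exists n.
move=> n; have [mG Gn] := Gfin n; split; first exact: measurableX.
apply: (@le_lt_trans _ _ (P setT * counting (G n))); last by rewrite probability_setT mul1e.
rewrite le_eqVlt; apply/orP; left; apply/eqP.
exact: (product_measure1E P counting measurableT mG).
Qed.

(* The library's sigma-finite instance on [product_measure1] requires both factors
   to be subprobabilities, which [counting] is not. *)
Definition product_counting : {sigma_finite_measure set (T * nat)%type -> \bar R} :=
  HB.pack (P \x @counting nat R) (Measure_isSigmaFinite.Build _ _ _
    (P \x @counting nat R) sigma_finite_product_counting).
End product_counting.

(** * Pointwise bounds for the maximal function *)

Section maximal.
Context {R : realType} (T : Type).
Implicit Type f : nat -> T -> R[i].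

Lemma normc_le_maximal_function f n t : (Normc.normc (f n t))%:E <= maximal_function f t.
Proof. by apply: ereal_sup_ubound; exists n. Qed.

Lemma maximal_function_ge0 f t : 0 <= maximal_function f t.
Proof. by apply: le_trans (normc_le_maximal_function f 0 t); rewrite lee_fin normc_ge0. Qed.

End maximal.

Lemma ge0_le_poweR (R : realType) (r : R) (x y : \bar R) : (0 <= r)%R ->
  0 <= x -> x <= y -> x `^ r <= y `^ r.
Proof.
move=> r0 x0 xy; apply: gt0_ler_poweR => //; rewrite in_itv/= leey andbT//.
exact: le_trans xy.
Qed.

(** * The Carleson embedding inequality *)

Section embedding.
Context {R : realType} d (T : measurableType d) (P : probability T R).
Variables (F : nat -> set (set T)) (alpha : R) (w : nat -> {RV P >-> R}).
Hypotheses (hF : filtration F) (w0 : forall k t, (0 <= w k t)%R).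
Hypothesis alpha0 : (0 < alpha)%R.
Variables (K : scalar_field) (f : nat -> T -> R[i]).
Hypothesis hf : adapted K F f.
Local Notation nu := (weighted_measure P w0).
Local Notation c := (carleson_norm P F alpha nu).
Local Notation M := (maximal_function f).

Lemma weighted_measure_superlevel_le (r s : R) : (0 <= r)%R ->
  nu [set x | (s < Normc.normc (f x.2 x.1) `^ r)%R]
  <= c * P [set t | s%:E < M t `^ r] `^ (1 + 2 * alpha).
Proof.
move=> r0; have mM := measurable_maximal_function hF hf.
pose A n := [set t | (s < Normc.normc (f n t) `^ r)%R].
have FA n : F n (A n).
  rewrite (_ : A n = (fun t => Normc.normc (f n t)) @^-1` [set u | (s < u `^ r)%R])//.
  apply: adapted_normc hF hf _.
  apply: (@measurable_superlevel _ _ R (fun u : R => (u `^ r)%:E)).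
  by apply/measurable_EFinP; exact: measurable_powR.
have [tau [htau tauA Atau]] := hitting_time hF FA.
have mtau := measurable_tent hF htau.
have mfin := measurable_finite_event hF htau.
have mA : measurable [set x : T * nat | A x.2 x.1].
  apply: (@measurable_superlevel _ _ _ (fun x : T * nat => (Normc.normc (f x.2 x.1) `^ r)%:E)).
  apply/measurable_EFinP; apply: (@measurableT_comp _ _ _ _ _ _ (fun u : R => u `^ r)%R).
    exact: measurable_powR.
  apply: (measurable_nat_prod (g := fun n t => Normc.normc (f n t))) => n.
  exact: measurable_normc_adapted hF hf.
apply: (@le_trans _ _ (nu (tent tau))); first by apply: le_measure; rewrite ?inE.
apply: le_trans (le_carleson_norm hF w0 alpha0 htau) _.
apply: lee_wpmul2l; first exact: carleson_norm_ge0.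
apply: ge0_le_poweR => //; first by rewrite addr_ge0// mulr_ge0// ltW.
apply: le_measure; rewrite ?inE//.
  by apply: measurable_superlevel; exact: (measurableT_comp (measurable_poweR r)).
(* Where [tau] is finite, some [|f_n|^r] exceeds [s], and [M] dominates [|f_n|]. *)
move=> t /tauA[n _ Ant] /=.
apply: (@lt_le_trans _ _ ((Normc.normc (f n t))%:E `^ r)); first by rewrite lte_fin.
by apply: ge0_le_poweR; rewrite ?lee_fin ?normc_ge0//; exact: normc_le_maximal_function.
Qed.

Lemma superlevel_poweR_le (r s : R) : (0 < r)%R -> (0 < s)%R ->
  (s `^ r^-1)%:E * P [set t | s%:E < M t `^ r] `^ (2 * alpha)
  <= 'N[P]_((1 / (2 * alpha))%:E)[M].
Proof.
move=> r0 s0; have mM := measurable_maximal_function hF hf.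
have a0 : (0 < 1 / (2 * alpha))%R by rewrite divr_gt0// mulr_gt0.
apply: le_trans (chebyshev_Lnorm P mM a0 (powR_gt0 r^-1 s0)).
rewrite (_ : (1 / (2 * alpha))^-1 = 2 * alpha)%R; last by rewrite div1r invrK.
apply: lee_wpmul2l; first by rewrite lee_fin powR_ge0.
apply: ge0_le_poweR => //; first by rewrite mulr_ge0// ltW.
apply: le_measure; rewrite ?inE//.
- by apply: measurable_superlevel; exact: (measurableT_comp (measurable_poweR r)).
- exact: measurable_superlevel.
move=> t /=; rewrite !ltNge; apply: contra => Ms.
have -> : s%:E = (s `^ r^-1)%:E `^ r.
  by rewrite poweR_EFin -powRrM mulVf ?gt_eqF// powRr1// ltW.
by apply: ge0_le_poweR => //; [exact: ltW|exact: maximal_function_ge0].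
Qed.

Lemma carleson_embedding (p : R) : (1 < p)%R ->
  \int[P \x counting]_x (Normc.normc (f x.2 x.1) `^ p * w x.2 x.1)%:E
       <= (p / (p - 1))%:E * c * 'N[P]_((1 / (2 * alpha))%:E)[M]
          * 'N[P]_((p - 1)%:E)[M] `^ (p - 1).
Proof.
move=> p1; have mM := measurable_maximal_function hF hf.
have p10 : (0 < p - 1)%R by rewrite subr_gt0.
pose b := ((p - 1)^-1)%R; have b0 : (0 < b)%R by rewrite invr_gt0.
(* This [b] satisfies both [b + 1 = p / (p - 1)] and [(p - 1) * (b + 1) = p]: the constant and the
   power of [|f_k|] come from the same exponent. *)
have b1 : (0 < b + 1)%R by rewrite addr_gt0.
have bE : (p / (p - 1) = b + 1)%R.
  by rewrite -[X in (X / _)%R](subrK 1%R p) mulrDl divff ?gt_eqF// div1r addrC.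
pose h x := (Normc.normc (f x.2 x.1) `^ (p - 1))%R.
have mh : measurable_fun setT h.
  apply: (@measurableT_comp _ _ _ _ _ _ (fun u : R => u `^ (p - 1))%R).
    exact: measurable_powR.
  apply: (measurable_nat_prod (g := fun n t => Normc.normc (f n t))) => n.
  exact: measurable_normc_adapted hF hf.
have mH : measurable_fun setT (fun t => M t `^ (p - 1)).
  exact: (measurableT_comp (measurable_poweR (p - 1))).
rewrite poweR_Lnorm ?gt_eqF//.
rewrite (_ : \int[P]_x _ = \int[P]_t (M t `^ (p - 1))); last first.
  by apply: eq_integral => t _; rewrite gee0_abs// maximal_function_ge0.
(* The right side also becomes an integral over levels [s], and the two integrands are compared
   pointwise below. *)
rewrite -(@integral_superlevel _ _ _ P)//; last by move=> t; exact: poweR_ge0.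
rewrite bE -!muleA.
rewrite (_ : \int[_]_x _ = (b + 1)%:E * \int[P \x counting]_x
    ((w x.2 x.1)%:E * (h x `^ (b + 1) / (b + 1))%:E)); last first.
  rewrite -ge0_integralZl_EFin//; last 3 first.
  - by move=> x _; rewrite lee_fin mulr_ge0// divr_ge0 ?powR_ge0// ltW.
  - apply: emeasurable_funM; first exact: measurable_weight.
    apply/measurable_EFinP; apply: measurable_funM => //.
        apply: (@measurableT_comp _ _ _ _ _ _ (fun u : R => u `^ (b + 1))%R) => //.
  - exact: ltW.
  apply: eq_integral => x _; rewrite -!EFinM; congr EFin.
  rewrite [RHS]mulrCA [((b + 1) * _)%R]mulrCA divff ?gt_eqF// mulr1 mulrC.
  congr (_ * _)%R; rewrite /h -powRrM; congr powR.
  by rewrite mulrDr mulfV ?gt_eqF// mulr1 addrC subrK.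
apply: lee_wpmul2l; first by rewrite lee_fin ltW.
rewrite (@layer_cake _ _ _ (product_counting P) b _ h)//; last 4 first.
- exact: ltW.
- exact: measurable_weight.
- by move=> x; rewrite lee_fin.
- by move=> x; exact: powR_ge0.
have mP : measurable_fun setT (fun s : R => P [set t | s%:E < M t `^ (p - 1)]).
  have := @measurable_integral_superlevel _ _ _ P (cst 1) _ (@measurable_cst _ _ _ _ _ _) mH.
  move=> /(_ (fun=> lee01)); congr measurable_fun; apply/funext => s.
  by rewrite integral_cst ?mul1e//; exact: measurable_superlevel.
have c0 : 0 <= c by exact: carleson_norm_ge0.
rewrite muleA -ge0_integralZl//; last 3 first.
- by apply: emeasurable_funM => //; exact: measurable_pos_powR.
- by move=> s _; rewrite mule_ge0// pos_powR_ge0.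
- by rewrite mule_ge0// Lnorm_ge0.
apply: ge0_le_integral => //.
- move=> s _; rewrite mule_ge0 ?pos_powR_ge0//; apply: integral_ge0 => x _.
  by rewrite lee_fin.
- apply: emeasurable_funM; first exact: measurable_pos_powR.
  apply: (@measurable_integral_superlevel _ _ _ (product_counting P) _ (EFin \o h)) => //.
  + exact: measurable_weight.
  + exact/measurable_EFinP.
  + by move=> x; rewrite lee_fin.
- apply: measurable_funeM.
  by apply: emeasurable_funM => //; exact: measurable_pos_powR.
move=> s _; rewrite /pos_powR !patchE; case: ifPn => [|_]; last by rewrite !mul0e mule0.
rewrite inE/= in_itv/= andbT => s0; rewrite powRr0 mul1e.
set PS := P _; have PS0 : 0 <= PS by exact: measure_ge0.
(* The inner integral is by definition the [nu]-measure of the set where [h] exceeds [s]. *)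
apply: (@le_trans _ _ ((s `^ b)%:E * (c * PS `^ (1 + 2 * alpha)))).
  apply: lee_wpmul2l; first by rewrite lee_fin powR_ge0.
  exact: weighted_measure_superlevel_le (ltW p10).
rewrite muleCA -muleA; apply: lee_wpmul2l => //.
rewrite addrC poweRD; last by rewrite add_neq0_poweRD_def// gt_eqF// addr_gt0// mulr_gt0.
rewrite poweRe1// muleA; apply: lee_wpmul2r => //.
exact: superlevel_poweR_le.
Qed.

End embedding.

Lemma powR_indic (R : realType) (T : Type) (A : set T) (r : R) (t : T) : r != 0%R ->
  ((\1_A t : R) `^ r = \1_A t)%R.
Proof. by move=> r0; rewrite indicE; case: (_ \in _); rewrite ?powR1 ?powR0. Qed.

Lemma Lnorm_indic (R : realType) d (T : measurableType d)
    (m : {measure set T -> \bar R}) (A : set T) (q : R) : measurable A -> q != 0%R ->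
  'N[m]_q%:E[EFin \o \1_A] = m A `^ q^-1.
Proof.
move=> mA q0; rewrite unlock; congr poweR.
under eq_integral => t _ do
  rewrite /= ger0_norm ?powR_indic// indicE.
by rewrite integral_indic// setIT.
Qed.

(** * The converse, tested on indicators of tents *)

Section tent_process.
Context {R : realType} d (T : measurableType d) (P : probability T R).
Variables (F : nat -> set (set T)) (alpha : R) (w : nat -> {RV P >-> R}).
Hypotheses (hF : filtration F) (w0 : forall k t, (0 <= w k t)%R).
Hypothesis alpha0 : (0 < alpha)%R.
Variables (tau : T -> option nat).
Hypothesis htau : stopping_time F tau.
Local Notation nu := (weighted_measure P w0).

(** The zero imaginary part makes one process serve real and complex scalars alike. *)
Definition tent_process (n : nat) (t : T) : R[i] :=
  Complex (\1_[set u | tent tau (u, n)] t)%R 0%R.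

Lemma adapted_tent_process (K : scalar_field) : adapted K F tent_process.
Proof.
split => [n t|n B mB|n B mB]; first by case: K.
  have sF := filtration_sigma hF n; move: B mB; apply/(sigma_algebra_preimage _ sF).
  apply: measurable_indic; rewrite /measurable/= sigma_algebra_id//; exact: htau.
have sF := filtration_sigma hF n; move: B mB; apply/(sigma_algebra_preimage _ sF).
exact: measurable_cst.
Qed.

Lemma normc_tent_process n t :
  Normc.normc (tent_process n t) = \1_(tent tau) (t, n) :> R.
Proof.
by rewrite normcE /= expr0n/= addr0 sqrtr_sqr ger0_norm.
Qed.

Lemma maximal_function_tent_process :
  maximal_function tent_process = EFin \o \1_(finite_event tau).
Proof.
apply/funext => t /=; apply/eqP; rewrite eq_le; apply/andP; split.
  apply: ub_ereal_sup => _ [n _ <-]; rewrite normc_tent_process lee_fin !indicE ler_nat.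
  case: (boolP (_ \in tent _)) => //; rewrite inE => -[k tk _].
  by rewrite mem_set//; exists k.
have [[k tk]|nt] := pselect (finite_event tau t); last first.
  by rewrite indicE memNset//; exact: maximal_function_ge0.
(* The supremum is attained at time [k = tau t], where the process already equals 1. *)
apply: le_trans (normc_le_maximal_function tent_process k t).
by rewrite normc_tent_process !indicE !mem_set//; exists k.
Qed.

Lemma integral_tent_process (p : R) : p != 0%R ->
  \int[P \x counting]_x (Normc.normc (tent_process x.2 x.1) `^ p * w x.2 x.1)%:E
  = nu (tent tau).
Proof.
move=> p0; rewrite /weighted_measure [RHS]integral_mkcond.
apply: eq_integral => x _.
rewrite normc_tent_process powR_indic// -surjective_pairing patchE indicE.
by case: ifPn; rewrite ?mul1r ?mul0r.
Qed.

Lemma tent_le (K : scalar_field) (p C : R) : (1 < p)%R ->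
  (forall f : nat -> T -> R[i], adapted K F f ->
    \int[P \x counting]_x (Normc.normc (f x.2 x.1) `^ p * w x.2 x.1)%:E
      <= C%:E * 'N[P]_((1 / (2 * alpha))%:E)[maximal_function f]
         * 'N[P]_((p - 1)%:E)[maximal_function f] `^ (p - 1)) ->
  nu (tent tau) <= C%:E * P (finite_event tau) `^ (1 + 2 * alpha).
Proof.
move=> p1 /(_ _ (adapted_tent_process K)).
have p10 : (p - 1 != 0)%R by rewrite gt_eqF// subr_gt0.
have a0 : (0 < 2 * alpha)%R by rewrite mulr_gt0.
have mfin := measurable_finite_event hF htau.
rewrite integral_tent_process ?gt_eqF ?(lt_trans _ p1)// maximal_function_tent_process.
rewrite !Lnorm_indic//; last by rewrite gt_eqF// divr_gt0.
(* The two norms contribute the powers [2 * alpha] and [(p - 1)^-1 * (p - 1) = 1] of the probability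
   that [tau] is finite. *)
rewrite -poweRrM mulVf// poweRe1// div1r invrK -muleA.
by rewrite addrC poweRD ?poweRe1// add_neq0_poweRD_def// gt_eqF// addr_gt0.
Qed.

End tent_process.

(** * Both implications assembled *)

Theorem theorem1p6 (R : realType) (d : measure_display) (T : measurableType d)
    (P : probability T R) (hP : measure_is_complete P)
    (F : nat -> set (set T)) (hF : filtration F)
    (K : scalar_field)
    (alpha : R) (halpha : (0 < alpha < 1)%R)
    (w : nat -> {RV P >-> R}) (w0 : forall k t, (0 <= w k t)%R) :
  (bounded_carleson P F alpha (weighted_measure P w0) ->
   forall (p : R) (f : nat -> T -> R[i]), (1 < p)%R -> adapted K F f ->
     \int[P \x counting]_x (Normc.normc (f x.2 x.1) `^ p * w x.2 x.1)%:E
       <= (p / (p - 1))%:E * carleson_norm P F alpha (weighted_measure P w0)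
          * 'N[P]_((1 / (2 * alpha))%:E)[maximal_function f]
          * 'N[P]_((p - 1)%:E)[maximal_function f] `^ (p - 1))
  /\
  (forall p C : R, (1 < p)%R ->
     (forall f : nat -> T -> R[i], adapted K F f ->
        \int[P \x counting]_x (Normc.normc (f x.2 x.1) `^ p * w x.2 x.1)%:E
          <= C%:E * 'N[P]_((1 / (2 * alpha))%:E)[maximal_function f]
             * 'N[P]_((p - 1)%:E)[maximal_function f] `^ (p - 1)) ->
     bounded_carleson P F alpha (weighted_measure P w0) /\
     carleson_norm P F alpha (weighted_measure P w0) <= C%:E).
Proof.
have /andP[alpha0 _] := halpha; split => [_ p f p1 hf|p C p1 hC].
  exact: (carleson_embedding hF w0 alpha0 hf p1).
(* This bound also gives boundedness, as [C] is a real number. *)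
have cC : carleson_norm P F alpha (weighted_measure P w0) <= C%:E.
  apply: ub_ereal_sup => _ [tau [htau P0] <-].
  have mfin := measurable_finite_event hF htau.
  rewrite lee_pdiv_fin ?poweR_gt0 ?fin_num_poweR ?fin_num_measure//.
  exact: tent_le hC.
by split => //; apply: le_lt_trans cC _; rewrite ltry.
Qed.
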